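(* There is a function $q\colon \mathbb{N}^2 \to \mathbb{N}$ such that, for every $c,d,k\in \mathbb{N}$, the following hold. (i) Every finite graph that has a $(k,d)$-centred tree-decomposition is $q(k,d)$-quasi-isometric to a finite graph with treewidth at most $2k-1$. (ii) Every finite graph that is $c$-quasi-isometric to a finite graph with treewidth at most $k$ has a $(k+1,3c^2)$-centred tree-decomposition.
   Context: $\mathbb{N}$ is the set of positive integers. Graphs are simple, undirected, unweighted and finite (not necessarily connected). $\operatorname{dist}_G(u,v)$ is the length of a shortest path between $u$ and $v$ in $G$, and is $\infty$ if no such path exists. Quasi-isometry: for $q\in\mathbb{N}$, a $q$-quasi-isometry of $G$ into $H$ is a map $\phi\colon V(G)\to V(H)$ such that $q^{-1}\operatorname{dist}_G(u,v)-q\le \operatorname{dist}_H(\phi(u),\phi(v))\le q\operatorname{dist}_G(u,v)+q$ for all $u,v\in V(G)$, and for every $x\in V(H)$ there is $v\in V(G)$ with $\operatorname{dist}_H(x,\phi(v))\le q$. If such a map exists, $G$ is $q$-quasi-isometric to $H$. Decompositions: for a tree $T$, a $T$-decomposition of $G$ is a pair $(T,\beta)$ with $\beta\colon V(T)\to 2^{V(G)}$ such that for every edge $uv\in E(G)$ some node $x\in V(T)$ has $u,v\in\beta(x)$, and for every $v\in V(G)$ the set $\{x\in V(T): v\in\beta(x)\}$ induces a non-empty connected subtree of $T$. The sets $\beta(x)$ are the bags. The width of $(T,\beta)$ is $\max_x|\beta(x)|-1$. A tree-decomposition is a $T$-decomposition for some tree $T$. The treewidth of $G$ is the minimum width of a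 tree-decomposition of $G$. Centred sets: the weak diameter of $X\subseteq V(G)$ is the maximum of $\operatorname{dist}_G(u,v)$ over $u,v\in X$ (distances measured in $G$). A set $S\subseteq V(G)$ is $(k,d)$-centred if $S$ has a partition into at most $k$ sets, each of weak diameter at most $d$. A tree-decomposition of $G$ is $(k,d)$-centred if each of its bags is $(k,d)$-centred. *)

(* Defs.v *)
From mathcomp Require Import all_boot all_order all_algebra.
From mathcomp Require Import boolp constructive_ereal.

Set Implicit Arguments.
Unset Strict Implicit.
Unset Printing Implicit Defensive.

Import Order.TTheory GRing.Theory Num.Theory.

Local Open Scope ring_scope.

(** The graph with no vertices is allowed; trees are nonempty. *)

Record sgraph := SGraph {
  vertex :> finType;
  edge : rel vertex;
  edge_sym : symmetric edge;
  edge_irrefl : irreflexive edge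
}.

Section Distance.
Variable G : sgraph.
Implicit Types (u v : G) (X S : {set G}).

Definition is_gpath u v (p : seq G) : bool :=
  [&& path (@edge G) u p, last u p == v & uniq (u :: p)].

Definition gpath_of_length u v (n : nat) : bool :=
  [exists p : n.-tuple G, is_gpath u v p].

Lemma connect_gpath u v :
  connect (@edge G) u v -> exists n, gpath_of_length u v n.
Proof.
move=> /connectP[p /shortenP[p' up' uniq_p' _] ->].
exists (size p'); apply/existsP; exists (in_tuple p').
by rewrite /is_gpath up' uniq_p' eqxx.
Qed.

Definition dist u v : \bar rat :=
  if @idP (connect (@edge G) u v) is ReflectT uv
  then (ex_minn (connect_gpath uv))%:R%:E else +oo%E.

(** Distances are nonnegative, so starting the maximum at 0 only matters for
    the empty set. *)
Definition weak_diameter X : \bar rat :=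
  \big[maxe/0%E]_(u in X) \big[maxe/0%E]_(v in X) dist u v.

Definition centred_set (k d : nat) S : Prop :=
  exists P : {set {set G}},
    [/\ partition P S, (#|P| <= k)%N
      & forall X, X \in P -> (weak_diameter X <= d%:R%:E)%E].

Definition induces_connected X : Prop :=
  X != set0 /\
  {in X &, forall u v,
    connect [rel a b | [&& a \in X, b \in X & edge a b]] u v}.

Definition acyclic : Prop :=
  forall c : seq G, (2 < size c)%N -> ~ ucycle (@edge G) c.

Definition is_tree : Prop := induces_connected [set: G] /\ acyclic.

End Distance.

Definition quasi_isometry (q : nat) (G H : sgraph) (phi : G -> H) : Prop :=
  (forall u v : G,
     ((q%:R^-1)%:E * dist u v - q%:R%:E <= dist (phi u) (phi v))%E /\
     (dist (phi u) (phi v) <= q%:R%:E * dist u v + q%:R%:E)%E) /\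
  (forall x : H, exists v : G, (dist x (phi v) <= q%:R%:E)%E).

Definition quasi_isometric (q : nat) (G H : sgraph) : Prop :=
  exists phi : G -> H, quasi_isometry q phi.

Section TreeDecomposition.
Variable G : sgraph.

Definition tree_decomposition (T : sgraph) (bag : T -> {set G}) : Prop :=
  [/\ is_tree T,
      forall u v : G, edge u v -> exists x, u \in bag x /\ v \in bag x
    & forall v : G, induces_connected [set x | v \in bag x]].

(** An integer: the graph with no vertices has a decomposition of width -1. *)
Definition width (T : sgraph) (bag : T -> {set G}) : int :=
  (\max_(x : T) #|bag x|)%:Z - 1.

(** Widths are at least -1, so they are enumerated by [n%:Z - 1] for [n : nat]. *)
Definition width_attained (n : nat) : bool :=
  `[< exists (T : sgraph) (bag : T -> {set G}),
        tree_decomposition bag /\ width bag = n%:Z - 1 >].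

Lemma width_attained_ex : exists n, width_attained n.
Proof.
pose T := @SGraph unit (fun _ _ => false) (fun _ _ => erefl) (fun _ => erefl).
pose bag := fun _ : T => [set: G].
exists (\max_(x : T) #|bag x|)%N; apply/asboolP; exists T, bag; split => //.
split=> [|u v _|v].
- split; last by case=> [//|a [//|b c]] _; rewrite /ucycle /=.
  split; first by apply/set0Pn; exists tt.
  by move=> [] [] _ _; exact: connect0.
- by exists tt; rewrite !inE.
- split; first by apply/set0Pn; exists tt; rewrite !inE.
  by move=> [] [] _ _; exact: connect0.
Qed.

Definition treewidth : int := (ex_minn width_attained_ex)%:Z - 1.

Definition has_centred_tree_decomposition (k d : nat) : Prop :=
  exists (T : sgraph) (bag : T -> {set G}),
    tree_decomposition bag /\ forall x : T, centred_set k d (bag x).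

End TreeDecomposition.

(* Main.v *)
Require Import Defs.
From mathcomp Require Import all_boot all_order all_algebra.
From mathcomp Require Import boolp constructive_ereal.
From mathcomp Require Import zify.

(** Part (ii): if [phi] is a [c]-quasi-isometry from [G] to [H], replace every
    bag [B] of a decomposition of [H] by the set of vertices that [phi] maps
    within distance [c] of [B]; a fibre over a single vertex of [B] has weak
    diameter at most [c * 2c + c^2].

    Part (i): make two vertices adjacent when they share a bag and are within
    distance [d]; then no bag contains more than [k] pairwise non-adjacent
    vertices. It suffices to 2-colour such a graph so that monochromatic
    components have bounded weak diameter: contracting the components is a
    quasi-isometry, and a bag meets at most [k] components of each colour.

    The colouring is built by induction on [k]. Root the tree and cut it into
    pieces from the root downwards: a node [x] stays in the piece with root [y]
    as long as its bag comes within distance 1 of [bag y]. A vertex belongs to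
    the piece of the topmost node whose bag contains it. In the piece of [y],
    colour the vertices within distance 1 of [bag y] false and those at distance
    2, ..., r + 2 true. Every bag of the piece contains a vertex near [bag y]
    which is far from all the remaining vertices (the core), so these satisfy
    the hypothesis with [k - 1], even for adjacency at scale [r], and are
    coloured by induction. An edge between two pieces joins the root bag of the
    lower piece to the layer coloured false, and this layer is surrounded by
    true vertices, so monochromatic components cannot spread over many
    pieces. *)

Set Implicit Arguments.
Unset Strict Implicit.
Unset Printing Implicit Defensive.

Import Order.TTheory GRing.Theory Num.Theory.
Local Open Scope ring_scope.
Local Open Scope nat_scope.

(** * Bounded distance *)

Section Near.
Variables (V : Type) (e : rel V).

Definition near (n : nat) (u v : V) : Prop :=
  exists p, [/\ path e u p, last u p = v & size p <= n].

Lemma near_refl n u : near n u u.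
Proof. by exists [::]. Qed.

Lemma near_edge u v : e u v -> near 1 u v.
Proof. by move=> uv; exists [:: v]; rewrite /= uv. Qed.

Lemma near_le m n u v : m <= n -> near m u v -> near n u v.
Proof. by move=> mn [p [pp lp sp]]; exists p; split=> //; apply: leq_trans mn. Qed.

Lemma near_trans m n u v w : near m u v -> near n v w -> near (m + n) u w.
Proof.
move=> [p [pp lp sp]] [q [pq lq sq]]; exists (p ++ q).
by rewrite cat_path last_cat lp pp pq size_cat leq_add.
Qed.

Lemma near_trans_le m n N u v w :
  near m u v -> near n v w -> m + n <= N -> near N u w.
Proof. by move=> uv vw /near_le; apply; apply: near_trans uv vw. Qed.

Lemma near_sym n u v : symmetric e -> near n u v -> near n v u.
Proof.
move=> sym_e [p [pp <- sp]]; apply: near_le sp _.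
elim: p u pp => [|w p IHp] u /=; first by move=> _; apply: near_refl.
case/andP=> uw /IHp wv; rewrite -addn1; apply: near_trans wv _.
by apply: near_edge; rewrite sym_e.
Qed.

Lemma near_rcons n u v w : near n u v -> e v w -> near n.+1 u w.
Proof. by move=> uv /near_edge vw; rewrite -addn1; apply: near_trans vw. Qed.

End Near.

Lemma near1P (V : eqType) (e : rel V) u v :
  near e 1 u v <-> (u == v) || e u v.
Proof.
split; last by case/orP=> [/eqP->|]; [exact: near_refl|exact: near_edge].
case=> [[|w [|w' p]] [/= pp <- //]]; first by rewrite eqxx.
by move: pp; rewrite andbT => ->; rewrite orbT.
Qed.

Lemma near_split (V : Type) (e : rel V) m n u v : near e (m + n) u v ->
  exists w, near e m u w /\ near e n w v.
Proof.
move=> [p [pp lp sp]]; exists (last u (take m p)).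
rewrite -(cat_take_drop m p) cat_path last_cat in pp lp.
case/andP: pp => ppt ppd; split; [exists (take m p)|exists (drop m p)]; split=> //.
  by rewrite size_take; case: ltnP => //; lia.
by rewrite size_drop; lia.
Qed.

Lemma near_scale (V : Type) (e e' : rel V) (m n : nat) u v :
  (forall a b, e' a b -> near e m a b) -> near e' n u v -> near e (m * n) u v.
Proof.
move=> ee' [p [pp <- sp]].
apply: (@near_le _ _ (m * size p)); first by rewrite leq_mul2l sp orbT.
elim: p u pp {sp} => [|w p IHp] u /=; first by move=> _; apply: near_refl.
by case/andP=> /ee' uw /IHp wv; rewrite mulnS; apply: near_trans wv.
Qed.

Lemma connect_ind (V : finType) (e : rel V) (P : V -> Prop) u v :
  P u -> (forall a b, connect e u a -> P a -> e a b -> P b) ->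
  connect e u v -> P v.
Proof.
move=> Pu Pe /connectP[p pp ->]; move: pp.
elim/last_ind: p => [//|p w IHp]; rewrite rcons_path last_rcons => /andP[pp ew].
by apply: Pe (IHp pp) ew; apply/connectP; exists p.
Qed.

(** * Independent sets and shortcuts along walks *)

Definition independent (V : eqType) (e : rel V) : seq V -> bool :=
  pairwise [rel u v | (u != v) && ~~ e u v].

Lemma split_last (V : Type) (Q : pred V) a p :
  Q a -> ~~ Q (last a p) ->
  exists p1 c p2, [/\ p = p1 ++ c :: p2, Q (last a p1) & all (predC Q) (c :: p2)].
Proof.
move=> Qa; elim/last_ind: p => [|p w IHp]; first by rewrite /= Qa.
rewrite last_rcons => nQw; case: (boolP (Q (last a p))) => [Ql|/IHp].
  by exists p, w, [::]; rewrite cats1 /= nQw.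
move=> [p1 [c [p2 [-> Ql nQ]]]]; exists p1, c, (rcons p2 w).
by rewrite rcons_cat -rcons_cons all_rcons nQ /= nQw.
Qed.

(* The greedy step jumps from [a] past the last vertex of the walk adjacent
   to [a]; the rest of the walk avoids the neighbourhood of [a]. *)
Lemma hops_near (V : eqType) (e h : rel V) (L k : nat) (X : V -> Prop) a p :
  symmetric e ->
  (forall s, (forall u, u \in s -> X u) -> independent e s -> size s <= k) ->
  (forall u v, h u v -> near e L u v) ->
  path h a p -> (forall u, u \in a :: p -> X u) ->
  near e (k * L.+1) a (last a p).
Proof.
move=> sym_e; elim: k X a p => [|k IHk] X a p alpha hL pp Xp.
  suff: size [:: a] <= 0 by [].
  by apply: alpha => // u; rewrite inE => /eqP->; apply: Xp; rewrite mem_head.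
pose Q := [pred u | (a == u) || e a u].
case: (boolP (Q (last a p))) => [/near1P|nQl]; first by apply: near_le; nia.
have [|p1 [c [p2 [pE Ql nQ]]]] := @split_last _ Q a p _ nQl.
  by rewrite /= eqxx.
move: pp; rewrite pE cat_path last_cat /= => /and3P[_ hc pp2].
apply: (@near_trans_le _ _ L.+1 (k * L.+1) _ _ c); last by lia.
  by rewrite -add1n; apply: near_trans (hL _ _ hc); apply/near1P.
(* Prepending [a] to an independent set outside its closed neighbourhood keeps it independent, so
   the bound drops to [k]. *)
apply: (IHk (fun u => X u /\ ~~ Q u)) pp2 _ => // [s sX s_ind|u uc]; last first.
  split; last exact: (allP nQ u uc).
  by apply: Xp; rewrite pE inE mem_cat uc !orbT.
rewrite -ltnS; apply: (alpha (a :: s)) => [u|].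
  by rewrite inE => /predU1P[->|/sX[]//]; apply: Xp; rewrite mem_head.
move: s_ind; rewrite /independent /= => ->; rewrite andbT.
by apply/allP => u /sX[_] /=; rewrite negb_or.
Qed.

(** * Rooted forests and their pieces *)

Section RootedForest.
Variables (T : Type) (par : T -> T) (depth : T -> nat).

(* Roots are the fixed points of [par]. *)
Definition rooted_forest :=
  forall x, par x = x \/ depth x = (depth (par x)).+1.

Definition anc (z x : T) := exists n, iter n par z = x.

(** In a rooted forest, climbing from any node of [X] stays in [X] until it reaches [t]: this is a
    subtree with top [t], the empty one included. *)
Definition topped (t : T) (X : T -> Prop) :=
  forall x, X x -> x = t \/ par x <> x /\ X (par x).

Lemma anc_refl x : anc x x.
Proof. by exists 0. Qed.

Lemma anc_step z x : anc (par z) x -> anc z x.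
Proof. by case=> n <-; exists n.+1; rewrite iterSr. Qed.

Lemma anc_trans x y z : anc x y -> anc y z -> anc x z.
Proof. by move=> [m <-] [n <-]; exists (n + m); rewrite iterD. Qed.

Lemma anc_total z x y : anc z x -> anc z y -> anc x y \/ anc y x.
Proof.
move=> [m <-] [n <-]; case: (leqP m n) => [le_mn|/ltnW le_nm].
  by left; exists (n - m); rewrite -iterD subnK.
by right; exists (m - n); rewrite -iterD subnK.
Qed.

Lemma anc_proper z x : anc z x -> z = x \/ par z <> z /\ anc (par z) x.
Proof.
case=> -[|n]; first by left.
rewrite iterSr => nx; case: (pselect (par z = z)) => [rz|]; last by right; split=> //; exists n.
by left; rewrite -nx rz; elim: n {nx} => //= n <-.
Qed.

Hypothesis forestP : rooted_forest.

Lemma forest_ind (P : T -> Prop) :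
  (forall x, (par x <> x -> P (par x)) -> P x) -> forall x, P x.
Proof.
move=> Pstep x; have [n] := ubnP (depth x); elim: n x => // n IHn x le_n.
by apply: Pstep => nx; apply: IHn; case: (forestP x) => // dx; lia.
Qed.

Lemma anc_depth z x : anc z x -> z = x \/ depth x < depth z.
Proof.
case=> n; elim: n z => [|n IHn] z; first by left.
rewrite iterSr => /IHn; case: (forestP z) => [->//|dz [<-|]]; right; lia.
Qed.

Lemma anc_anti x y : anc x y -> anc y x -> x = y.
Proof. by move=> /anc_depth[//|?] /anc_depth[//|?]; lia. Qed.

Lemma topped_climb t X z x : topped t X -> X z -> anc z x -> X x \/ anc t x.
Proof.
move=> tX Xz [n]; elim: n z Xz => [|n IHn] z Xz; first by move=> <-; left.
case: (tX z Xz) => [zt nx|[_ Xpz]]; first by right; exists n.+1; rewrite -zt.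
by rewrite iterSr; apply: IHn.
Qed.

Lemma topped_anc t X z : topped t X -> X z -> anc z t.
Proof.
move=> tX; elim/forest_ind: z => z IHz Xz.
by case: (tX z Xz) => [->|[nz Xpz]]; [apply: anc_refl|apply/anc_step/IHz].
Qed.

Lemma topped_top t X z : topped t X -> X z -> X t.
Proof.
move=> tX Xz; have zt := topped_anc tX Xz.
elim/forest_ind: z Xz zt => z IHz Xz zt.
by case: (tX z Xz) => [<-//|[nz Xpz]]; apply: IHz (topped_anc tX Xpz).
Qed.

Lemma topped_between t X z x : topped t X -> X z -> anc z x -> anc x t -> X x.
Proof.
move=> tX Xz zx xt; case: (topped_climb tX Xz zx) => // tx.
by rewrite (anc_anti xt tx); apply: topped_top Xz.
Qed.

Definition is_exit (X : T -> Prop) x := X x /\ (par x = x \/ ~ X (par x)).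

Lemma unique_exit_topped (X : T -> Prop) (t0 : T) :
  (forall x y, is_exit X x -> is_exit X y -> x = y) -> exists t, topped t X.
Proof.
move=> uniq_exit; case: (pselect (exists x, is_exit X x)) => [[t Xt]|noexit].
  exists t => x Xx; case: (pselect (is_exit X x)) => [xe|xi]; first by left; apply: uniq_exit.
  right; split=> [px|]; first by apply: xi; split=> //; left.
  by apply: contrapT => nXp; apply: xi; split=> //; right.
exists t0 => x Xx; right; split=> [px|]; first by apply: noexit; exists x; split=> //; left.
by apply: contrapT => nXp; apply: noexit; exists x; split=> //; right.
Qed.

Lemma topped_exit t X x : topped t X -> is_exit X x -> x = t.
Proof. by move=> tX [/tX[//|[]]] px Xp [/px|]. Qed.

Section Pieces.
Variable hits : T -> T -> Prop.

(* [rho x] is the root of the piece containing [x]. *)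
Definition pieces (rho : T -> T) := forall x,
  if `[< par x <> x /\ hits x (rho (par x)) >] then rho x = rho (par x)
  else rho x = x.

Lemma pieces_exist : exists rho, pieces rho.
Proof.
(* [n] is fuel; any fuel of at least [depth x] gives the same value. *)
pose rec := fix rec n x {struct n} := if n is n'.+1 then
    if `[< par x <> x /\ hits x (rec n' (par x)) >] then rec n' (par x) else x
  else x.
have recE n x : depth x <= n -> rec n x = rec (depth x) x.
  elim: n x => [|n IHn] x xn; first by have ->: depth x = 0 by lia.
  case: (forestP x) => [px|dx].
    by case: (depth x) => [|m] /=; rewrite !asboolF // => -[].
  by rewrite dx /= IHn //; lia.
exists (fun x => rec (depth x) x) => x.
case: (forestP x) => [px|dx]; last by rewrite dx /=; case: ifP => h; rewrite h.
rewrite asboolF; last by case.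
by case: (depth x) => [|m] //=; rewrite asboolF // => -[].
Qed.

Variable rho : T -> T.
Hypothesis rhoP : pieces rho.

Lemma piece_root_or x : rho x = x \/
  [/\ par x <> x, rho x = rho (par x) & hits x (rho x)].
Proof.
have := rhoP x; case: ifP => [/asboolP[px h] rx|_]; last by left.
by right; rewrite rx.
Qed.

Lemma piece_anc x : anc x (rho x).
Proof.
elim/forest_ind: x => x IHx; case: (piece_root_or x) => [->|[px -> _]].
  exact: anc_refl.
exact: anc_step (IHx px).
Qed.

Lemma piece_idem x : rho (rho x) = rho x.
Proof.
elim/forest_ind: x => x IHx; case: (piece_root_or x) => [rx|[px rx _]].
  by rewrite !rx.
by rewrite rx; apply: IHx.
Qed.

Lemma piece_between z x : anc z x -> anc x (rho z) -> rho x = rho z.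
Proof.
elim/forest_ind: z => z IHz zx xr; case: (anc_proper zx) => [->//|[pz pzx]].
case: (piece_root_or z) => [rz|[_ rz _]].
  by rewrite rz in xr *; rewrite (anc_anti xr zx).
by rewrite rz in xr *; apply: IHz.
Qed.

Lemma piece_exit x : par x <> x -> rho x = x -> ~ hits x (rho (par x)).
Proof.
move=> px rx h; have := rhoP x; rewrite asboolT // rx => xr.
have := piece_anc (par x); rewrite -xr => px_x; apply: px.
by apply: anc_anti px_x (anc_step (anc_refl _)).
Qed.

End Pieces.

End RootedForest.

(** * Rooted tree-decompositions *)

Section RootedDecomposition.
Variables (V : finType) (T : Type) (e : rel V).
Variables (par : T -> T) (depth : T -> nat) (bag : T -> V -> Prop) (top : V -> T).

Definition bags_indep (k : nat) := forall x s,
  (forall u, u \in s -> bag x u) -> independent e s -> size s <= k.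

(* Vertices outside all bags are allowed, as the induction passes to the graph
   [sub_edge] below, where only core vertices lie in bags. *)
Definition rooted_dec :=
  [/\ symmetric e, rooted_forest par depth,
      forall u, topped par (top u) (bag^~ u)
    & forall u v, e u v -> exists x, bag x u /\ bag x v].

Definition touches r x u := exists w, near e r u w /\ bag x w.

Hypothesis decP : rooted_dec.
Let sym_e : symmetric e. Proof. by case: decP. Qed.
Let forestP : rooted_forest par depth. Proof. by case: decP. Qed.
Let topP u : topped par (top u) (bag^~ u). Proof. by case: decP. Qed.
Let edgeP u v : e u v -> exists x, bag x u /\ bag x v.
Proof. by case: decP => _ _ _; apply. Qed.

Lemma touches_le r r' x u : r <= r' -> touches r x u -> touches r' x u.
Proof. by move=> le_r [w [uw xw]]; exists w; split=> //; apply: near_le uw. Qed.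

Lemma touches_near m n N x u v :
  near e m u v -> touches n x v -> m + n <= N -> touches N x u.
Proof.
by move=> uv [w [vw xw]] le_N; exists w; split=> //; apply: near_trans_le uv vw _.
Qed.

Lemma touches_bag r x u : bag x u -> touches r x u.
Proof. by exists u; split=> //; apply: near_refl. Qed.

Lemma edge_bag u v : e u v -> bag (top u) u.
Proof. by move/edgeP => [x [xu _]]; exact: (topped_top forestP (@topP u) xu). Qed.

(** Both tops lie above a shared bag, so they are comparable, and the lower one lies between that
    bag and the upper top. *)
Lemma edge_top u v : e u v -> anc par (top v) (top u) /\ bag (top v) u \/
                              anc par (top u) (top v) /\ bag (top u) v.
Proof.
move=> /edgeP[x [xu xv]].
have au := topped_anc forestP (@topP u) xu; have av := topped_anc forestP (@topP v) xv.
case: (anc_total au av) => h; [right|left]; split=> //.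
  exact: (topped_between forestP (@topP v) xv au h).
exact: (topped_between forestP (@topP u) xu av h).
Qed.

Lemma below_bag u z x y : bag z u -> anc par z x ->
  par x = x \/ ~ bag (par x) u -> bag y u -> anc par y x.
Proof.
move=> zu zx px yu; have yt := topped_anc forestP (@topP u) yu.
apply: anc_trans yt _; case: (topped_climb (@topP u) zu zx) => // xu.
rewrite (@topped_exit _ par (top u) (bag^~ u) x) //.
exact: anc_refl.
Qed.

Lemma below_near x r c w :
  (forall v, near e r c v -> par x = x \/ ~ bag (par x) v) ->
  near e r c w ->
  (exists z, bag z c /\ anc par z x) <-> (exists z, bag z w /\ anc par z x).
Proof.
move=> out [p [pp <- sp]]; elim/last_ind: p pp sp => [//|p v IHp].
rewrite rcons_path size_rcons last_rcons => /andP[pp ev] sp.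
rewrite IHp ?(ltnW sp) //.
have outp : par x = x \/ ~ bag (par x) (last c p).
  by apply: out; exists p; split=> //; apply: ltnW.
have outv : par x = x \/ ~ bag (par x) v.
  by apply: out; exists (rcons p v); rewrite rcons_path last_rcons size_rcons pp.
have [y [yp yv]] := edgeP ev.
by split=> -[z [zu zx]]; exists y; split=> //; apply: below_bag zu zx _ _.
Qed.

(** The ball around [u] is connected and misses the bag above any exit that is not a root, so by
    [below_near] any two exits lie below each other. *)
Lemma ball_topped r u : exists t, topped par t (touches r ^~ u).
Proof.
apply: (unique_exit_topped (top u)).
suff below x y : is_exit par (touches r ^~ u) x ->
    is_exit par (touches r ^~ u) y -> anc par y x.
  by move=> x y ex ey; apply: (anc_anti forestP); apply: below.
case=> [[wx [uwx xwx]] outx] [[wy [uwy ywy]] _].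
have out v : near e r u v -> par x = x \/ ~ bag (par x) v.
  by move=> uv; case: outx => [|nX]; [left|right=> xv; apply: nX; exists v].
have [z [zu zx]] : exists z, bag z wy /\ anc par z x.
  apply/(below_near out uwy)/(below_near out uwx).
  by exists x; split=> //; apply: anc_refl.
exact: below_bag zu zx (out _ uwy) ywy.
Qed.

End RootedDecomposition.

(** * Two-colourings with bounded monochromatic components *)

Definition monochrome (V : Type) (e : rel V) (col : V -> bool) : rel V :=
  [rel a b | e a b && (col a == col b)].

Lemma monochrome_sym (V : Type) (e : rel V) col : symmetric e -> symmetric (monochrome e col).
Proof. by move=> sym_e a b; rewrite /monochrome /= sym_e eq_sym. Qed.

Lemma connect_monochrome_col (V : finType) (e : rel V) (col : V -> bool) u v :
  connect (monochrome e col) u v -> col v = col u.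
Proof.
apply: (connect_ind (P := fun v => col v = col u)) => // a b _ <-.
by case/andP=> _ /eqP.
Qed.

(** * The induction step: pieces and the graph on the core *)

Section Step.
Variables (V : finType) (T : Type) (e : rel V).
Variables (par : T -> T) (depth : T -> nat) (bag : T -> V -> Prop) (top : V -> T).
Hypothesis decP : rooted_dec e par depth bag top.
Let sym_e : symmetric e. Proof. by case: decP. Qed.
Let forestP : rooted_forest par depth. Proof. by case: decP. Qed.
Let bag_topped u : topped par (top u) (fun x => bag x u).
Proof. by case: decP => _ _ tP _; apply: tP. Qed.

Variable k : nat.
Hypothesis indepP : bags_indep e bag k.+1.

Definition hop (y : T) (L : nat) : rel V :=
  [rel a b | `[< [/\ bag y a, bag y b & near e L a b] >]].

(** The walk stays in one bag, whose independent sets have size at most [k.+1], so the number of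
    hops does not matter. *)
Lemma hop_near y L a b : bag y a -> connect (hop y L) a b -> near e (k.+1 * L.+1) a b.
Proof.
move=> ya /connectP[p pp ->].
apply: (@hops_near _ e (hop y L) L k.+1 (bag y)) (pp) _ => // [s|u v /asboolP[]//|u].
  exact: indepP.
rewrite inE => /predU1P[->//|].
elim: p a pp {ya} => //= w p IHp a /andP[/asboolP[_ yw _] pp].
by rewrite inE => /predU1P[->//|]; apply: IHp pp.
Qed.

Notation touches := (touches e bag).
Definition hits (x y : T) := exists w, bag x w /\ touches 1 y w.

Variable rho : T -> T.
Hypothesis rhoP : pieces par hits rho.

(** The bound of [hop_near] for hops of length 3, which arise from an edge between two vertices
    within 1 of a bag ([hop3]). *)
Let r := k.+1 * 4.
Let pi v := rho (top v).
Definition far n v := ~ touches n (pi v) v.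
Notation core := (far (r + 2)).

(** At scale [r + r + 1], core vertices of one piece are adjacent as soon as vertices of a common
    bag of that piece within [r] of them are equal or adjacent; [sub_indep] relies on this. *)
Definition sub_edge : rel V := fun a b =>
  `[< [/\ core a, core b, pi a = pi b, near e (r + r).+1 a b
        & exists x, [/\ rho x = pi a, touches r x a & touches r x b]] >].
Definition sub_bag x u := [/\ core u, rho x = pi u & touches r x u].

Lemma sub_edge_sym : symmetric sub_edge.
Proof.
suff h a b : sub_edge a b -> sub_edge b a by move=> a b; apply/idP/idP; apply: h.
case/asboolP=> Ca Cb ab nab [x [xa ax bx]]; apply/asboolP; split=> //.
  exact: near_sym.
by exists x; rewrite -ab.
Qed.

Lemma sub_edgeI a b : core a -> core b -> pi a = pi b -> near e r a b ->
  bag (top a) a -> sub_edge a b.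
Proof.
move=> Ca Cb ab nab ta; apply/asboolP; split=> //.
  by apply: near_le nab; lia.
exists (top a); split=> //; first exact: touches_bag.
by exists a; split=> //; apply: near_sym.
Qed.

(** The nodes meeting a ball ([ball_topped]) and the piece of [pi u] are subtrees; an exit of their
    intersection is one of the two tops, and these agree if both lie in it. *)
Lemma sub_dec : exists top', rooted_dec sub_edge par depth sub_bag top'.
Proof.
suff /choice[top' topP] : forall u, exists t, topped par t (fun x => sub_bag x u).
  exists top'; split=> //; first exact: sub_edge_sym.
  move=> u v /asboolP[Cu Cv uv _ [x [xu ux vx]]].
  by exists x; split; split=> //; rewrite -uv.
move=> u; have [t tP] := ball_topped decP r u.
have exitP x : is_exit par (fun x => sub_bag x u) x -> x = t \/ x = pi u.
  case=> -[Cu xu ux] outx; case: (tP x ux) => [|[px upx]]; first by left.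
  case: outx => [/px//|nX]; right; apply: contrapT => xpi; apply: nX; split=> //.
  by case: (piece_root_or rhoP x) => [xr|[_ <- _]//]; case: xpi; rewrite -xu.
have t_pi : sub_bag t u -> sub_bag (pi u) u -> t = pi u.
  move=> [_ tu _] [_ _ piu]; apply: (anc_anti forestP).
    by rewrite -tu; exact: (piece_anc forestP rhoP _).
  exact: (topped_anc forestP tP piu).
apply: (unique_exit_topped t) => x y ex ey.
have [[xu _] [yu _]] := (ex, ey); case: (exitP x ex) (exitP y ey) => xE [] yE.
- by rewrite xE yE.
- by move: xu yu; rewrite xE yE; apply: t_pi.
- by move: xu yu; rewrite xE yE => piu tu; symmetry; apply: t_pi.
- by rewrite xE yE.
Qed.

(** At a piece root [sub_bag] is empty. The bag of any other node has a vertex [w] within 1 of the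
    root bag; [w] and bag vertices within [r] of the members of [s] form an independent set with one
    element more than [s]. The core radius [r + 2] separates [w] from the others. *)
Lemma sub_indep : bags_indep sub_edge sub_bag k.
Proof.
move=> x s sB s_ind.
have [f fP] : exists f : V -> V, forall u, u \in s -> near e r u (f u) /\ bag x (f u).
  suff /choice[f fP] : forall u, exists w, u \in s -> near e r u w /\ bag x w by exists f.
  move=> u; case: (boolP (u \in s)) => [/sB[_ _ [w [uw xw]]]|_]; last by exists u.
  by exists w.
case: (piece_root_or rhoP x) => [rx|[_ _ [w [xw xrw]]]].
  case: s sB {s_ind fP} => [//|u s] sB; exfalso.
  have [Cu xu xtu] := sB u (mem_head _ _).
  by apply: Cu; rewrite -xu rx; apply: touches_le xtu; lia.
have far_f u : u \in s -> ~ near e 1 w (f u).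
  move=> us wfu; have [Cu xu _] := sB u us; have [ufu _] := fP u us.
  apply: Cu; rewrite -xu; apply: (touches_near ufu (n := 2)); last by lia.
  by apply: (touches_near _ xrw (m := 1)) => //; apply: near_sym.
rewrite -ltnS -(size_map f) -[X in X <= _]/(size (w :: map f s)).
apply: (indepP (x := x)) => [u|].
  by rewrite inE => /predU1P[->//|/mapP[v vs ->]]; have [] := fP v vs.
rewrite /independent /=; apply/andP; split.
  apply/allP => _ /mapP[u us ->] /=; rewrite -negb_or.
  by apply/negP => /near1P; apply: far_f.
rewrite pairwise_map; apply: (sub_in_pairwise (P := [in s])) s_ind; last exact/allP.
move=> a b sa sb /= /andP[_ nab]; have [afa xfa] := fP a sa; have [bfb xfb] := fP b sb.
rewrite -negb_or; apply: contra nab => /near1P fab; apply/asboolP.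
have [[Ca xa xta] [Cb xb xtb]] := (sB a sa, sB b sb).
split=> //; first by rewrite -xa.
  apply: (near_trans_le afa (n := r.+1)); last by lia.
  by apply: (near_trans_le fab (near_sym sym_e bfb)).
by exists x.
Qed.

(** Let [a] lie in the bag of [top b] but belong to another piece. Then [a] is in the bags of [y],
    the root of the piece of [b], and of [par y]. As [y] starts a new piece, [a] is not within 1 of
    the root bag of the piece above, so [top a] lies below that root. *)
Lemma cross_edge u v : e u v -> [\/ pi u = pi v,
    [/\ bag (pi v) u, far 1 u & pi u = rho (par (pi v))]
  | [/\ bag (pi u) v, far 1 v & pi v = rho (par (pi u))] ].
Proof.
have half a b : anc par (top b) (top a) -> bag (top b) a ->
    pi a = pi b \/ [/\ bag (pi b) a, far 1 a & pi a = rho (par (pi b))].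
  move=> ba tba; rewrite /far /pi; set y := rho (top b).
  have by_ : anc par (top b) y := piece_anc forestP rhoP _.
  have yy : rho y = y := piece_idem forestP rhoP _.
  case: (anc_total ba by_) => [ay|]; first by left; apply: (piece_between forestP rhoP).
  move=> ya; have yNa := topped_between forestP (@bag_topped a) tba by_ ya.
  case: (anc_proper ya) => [<-|[py pya]]; [by left|right].
  have nh := piece_exit forestP rhoP py yy; set y' := rho (par y) in nh *.
  have pyy' : anc par (par y) y' := piece_anc forestP rhoP _.
  have bpy : bag (par y) a.
    by apply: (topped_between forestP (@bag_topped a) yNa _ pya); apply/anc_step/anc_refl.
  have ra : rho (top a) = y'.
    case: (anc_total pya pyy') => [|y'a]; first exact: (piece_between forestP rhoP).
    case: nh; exists a; split=> //; apply: touches_bag.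
    exact: (topped_between forestP (@bag_topped a) bpy pyy' y'a).
  by split=> //; rewrite ra => h; apply: nh; exists a.
move=> /(edge_top decP)[[uv bu]|[uv bv]].
  by case: (half u v uv bu) => [->|h]; [constructor 1|constructor 2].
by case: (half v u uv bv) => [->|h]; [constructor 1|constructor 3].
Qed.

(** * The colouring of the induction step and its components *)

Variables (col' : V -> bool) (D : nat).
Hypothesis colP' : forall u v, connect (monochrome sub_edge col') u v -> near sub_edge D u v.

Let R := (r + r).+1 * D.

Lemma sub_near u v : connect (monochrome sub_edge col') u v -> near e R u v.
Proof. by move/colP'; apply: near_scale => a b /asboolP[]. Qed.

Definition step_col v : bool :=
  if `[< touches 1 (pi v) v >] then false
  else if `[< touches (r + 2) (pi v) v >] then true else col' v.
Notation col := step_col.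

Lemma col_close v : touches 1 (pi v) v -> col v = false.
Proof. by rewrite /col => /asboolT->. Qed.

Lemma core_far v : core v -> far 1 v.
Proof. by move=> Cv h; apply: Cv; apply: touches_le h; lia. Qed.

Lemma col_core v : core v -> col v = col' v.
Proof. by move=> Cv; rewrite /col !asboolF //; apply: core_far. Qed.

Lemma col_middle v : far 1 v -> ~ core v -> col v = true.
Proof. by rewrite /col => /asboolF-> /contrapT/asboolT->. Qed.

Lemma core_edge a b : e a b -> pi a = pi b -> core a -> core b -> col a = col b ->
  connect (monochrome sub_edge col') a b.
Proof.
move=> ab pab Ca Cb; rewrite !col_core // => cab; apply: connect1.
rewrite /monochrome /= cab eqxx andbT; apply: sub_edgeI => //.
  by apply: near_le (near_edge ab); rewrite /r; lia.
exact: (edge_bag decP ab).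
Qed.

Lemma cross_close u v : e u v -> bag (pi v) u -> touches 1 (pi v) v.
Proof. by move=> uv b; exists u; split=> //; apply: near_edge; rewrite sym_e. Qed.

Let sub_monochrome_sym : connect_sym (monochrome sub_edge col').
Proof. exact/sym_connect_sym/monochrome_sym/sub_edge_sym. Qed.

(** In use, [b] lies in the root bag of the piece of [w]. The radius is [r + 2] for a vertex outside
    the core, plus one edge. *)
Definition attached w b := exists z, connect (monochrome sub_edge col') w z /\
  near e (r + 3) z b.

Lemma attached_near w b : attached w b -> near e (R + (r + 3)) w b.
Proof. by move=> [z [/sub_near wz zb]]; apply: near_trans zb. Qed.

(** An edge between pieces has its lower end within 1 of a root bag, where the colour is false.
    Inside a piece, an end outside the core attaches both ends to the root bag. *)
Lemma true_edge a b : e a b -> col a -> col b -> pi a = pi b /\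
  (connect (monochrome sub_edge col') a b \/
   exists c, [/\ bag (pi a) c, attached a c & attached b c]).
Proof.
move=> ab ca cb; have pab : pi a = pi b.
  case: (cross_edge ab) => // -[bb _ _].
    by move: cb; rewrite col_close //; apply: cross_close bb.
  by move: ca; rewrite col_close //; apply: cross_close bb; rewrite sym_e.
split=> //.
have att x y c : e x y -> near e (r + 2) x c -> attached x c /\ attached y c.
  move=> xy xc; split; [exists x|exists y]; split=> //; try exact: connect0.
    by apply: near_le xc; lia.
  by apply: (near_trans_le (near_edge _) xc); [rewrite sym_e|lia].
case: (pselect (core a)) => [Ca|/contrapT[c [ac pc]]]; last first.
  by right; exists c; have [] := att a b c ab ac.
case: (pselect (core b)) => [Cb|/contrapT[c [bc pc]]].
  by left; apply: core_edge => //; rewrite ca cb.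
right; exists c; rewrite pab; have [|bc' ac'] := att b a c _ bc; last by split.
by rewrite sym_e.
Qed.

(** Bounds the distance between two vertices to which the same vertex is attached. *)
Let L := (R + (r + 3)) * 2.

(** A walk leaving its first component of the core graph is followed by hops in the root bag of the
    piece, through vertices to which the walk is attached; [hop_near] bounds these. *)
Lemma true_component u w : col u -> connect (monochrome e col) u w ->
  near e (L + k.+1 * L.+1) u w.
Proof.
move=> cu uw.
pose inv w := connect (monochrome sub_edge col') u w \/ exists b b',
  [/\ bag (pi u) b /\ bag (pi u) b', attached u b, attached w b' & connect (hop (pi u) L) b b'].
have [cw [pw invw]] : col w /\ pi w = pi u /\ inv w.
  apply: (connect_ind (P := fun w => col w /\ pi w = pi u /\ inv w)) uw => [|a b _ [ca [pa inva]] /andP[ab /eqP cab]].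
    by split=> //; split=> //; left; apply: connect0.
  have cb : col b by rewrite -cab.
  have [pab abE] := true_edge ab ca cb; split=> //; split; first by rewrite -pab.
  case: inva => [ua|[c [c' [[uc uc'] att_c att_c' cc']]]]; case: abE => [ab'|[d [pd ad bd]]].
  - by left; apply: connect_trans ab'.
  - right; exists d, d; split=> //; first by rewrite -pa.
      by case: ad => z [az zd]; exists z; split=> //; apply: connect_trans az.
  - right; exists c, c'; split=> //; case: att_c' => z [az zc]; exists z; split=> //.
    apply: connect_trans az.
    by rewrite sub_monochrome_sym.
  - rewrite pa in pd; right; exists c, d; split=> //; apply: (connect_trans cc'); apply: connect1.
    apply/asboolP; split=> //.
    apply: (near_trans_le (near_sym sym_e (attached_near att_c')) (attached_near ad)).
    by rewrite /L; lia.
case: invw => [/sub_near|[b [b' [[ub _] ab ab' bb']]]]; first by apply: near_le; rewrite /L; lia.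
have b'w := near_sym sym_e (attached_near ab').
apply: (near_trans_le (attached_near ab) (near_trans (hop_near ub bb') b'w)).
by rewrite /L; lia.
Qed.
Lemma false_touch v : col v = false -> core v \/ touches 1 (pi v) v.
Proof.
move=> cv; case: (pselect (core v)) => [|nC]; [by left|right].
by apply: contrapT => fv; move: cv; rewrite col_middle.
Qed.

Definition cross a b := [/\ bag (pi b) a, far 1 a & pi a = rho (par (pi b))].

(** The upper end of an edge between pieces is not within 1 of its root bag, so being false it is
    core; the lower end is within 1 of its own. Inside a piece, a core vertex has no neighbour
    within 1 of the root bag. *)
Lemma false_edge a b : e a b -> col a = false -> col b = false ->
  [\/ [/\ core a, core b & connect (monochrome sub_edge col') a b],
      [/\ core a, touches 1 (pi b) b & cross a b],
      [/\ touches 1 (pi a) a, core b & cross b a]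
    | [/\ touches 1 (pi a) a, touches 1 (pi b) b & pi a = pi b] ].
Proof.
have not_next x y : e x y -> core x -> touches 1 (pi y) y -> pi x <> pi y.
  move=> xy Cx ty pxy; apply: Cx; rewrite pxy.
  by apply: (touches_near (near_edge xy) ty); lia.
move=> ab ca cb; have ba : e b a by rewrite sym_e.
case: (false_touch ca) (false_touch cb) (cross_edge ab) => [Ca|ta] [Cb|tb] [pab|crs|crs].
- by constructor 1; split=> //; apply: core_edge => //; rewrite ca cb.
- by case: (core_far Cb); apply: cross_close ab _; case: crs.
- by case: (core_far Ca); apply: cross_close ba _; case: crs.
- by case: (not_next a b).
- by constructor 2.
- by case: crs => _ /(_ tb).
- by case: (not_next b a).
- by case: crs => _ /(_ ta).
- by constructor 3.
- by constructor 4.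
- by case: crs => _ /(_ ta).
- by case: crs => _ /(_ tb).
Qed.

Lemma hop3 y w w' b b' : bag y b -> bag y b' -> near e 1 w b -> near e 1 w' b' ->
  e w w' -> hop y 3 b b'.
Proof.
move=> yb yb' wb wb' ww'; apply/asboolP; split=> //.
apply: (near_trans_le (near_sym sym_e wb) (n := 2)) => //.
exact: near_trans (near_edge ww') wb'.
Qed.

(* A false-coloured walk can leave the core only by entering the vicinity of
   the root bag of a child piece, and it returns to the core within [r]. *)
Lemma false_core_component u w : col u = false -> core u -> connect (monochrome e col) u w ->
  near e (R + r + 1) u w.
Proof.
move=> cu Cu uw.
(* The walk last left the core at [u'], which lies in the root bag of a child piece; hops in that
   bag have followed it since. *)
pose detour w := exists u' b, [/\ connect (monochrome sub_edge col') u u',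
  col u' = false /\ core u', cross u' w, bag (pi w) b /\ near e 1 w b
  & connect (hop (pi w) 3) u' b].
pose inv w := core w /\ connect (monochrome sub_edge col') u w \/
  touches 1 (pi w) w /\ detour w.
have [cw invw] : col w = false /\ inv w.
  apply: (connect_ind (P := fun w => col w = false /\ inv w)) uw => [|a b _ [ca inva]].
    by split=> //; left; split=> //; apply: connect0.
  case/andP=> ab /eqP cab; have cb : col b = false by rewrite -cab.
  split=> //; case: (false_edge ab ca cb) inva => [[Ca Cb ab']|[Ca tb crs]|[ta Cb crs]|[ta tb pab]];
    case=> [[Ca' ua]|[ta' [u' [c [uu' [cu' Cu'] crs' [pc ac] u'c]]]]].
  - by left; split=> //; apply: connect_trans ab'.
  - by case: (core_far Ca).
  - right; split=> //; exists a, a; split=> //.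
    by case: crs => ? _ _; split=> //; apply: near_edge; rewrite sym_e.
  - by case: (core_far Ca).
  - by case: (core_far Ca').
  (* Back in the core at [b]: [u'] and [b] both lie in the root bag of the child piece and are
     joined by hops, so they are within [r] and adjacent in the core graph. *)
  - left; split=> //; apply: (connect_trans uu'); apply: connect1.
    rewrite /monochrome /= -!col_core // cu' cb eqxx andbT.
    case: crs => pb fb pbE; case: crs' => pu' fu' pu'E.
    have nb : near e r u' b.
      rewrite /r; apply: hop_near pu' (connect_trans u'c (connect1 _)).
      by apply: hop3 pc pb ac (near_refl _ _ _) ab.
    apply: sub_edgeI => //; first by rewrite pu'E pbE.
    exact: (topped_top forestP (@bag_topped u') pu').
  - by case: (core_far Ca').
  - right; split=> //; case: tb => d [bd pd]; exists u', d; split=> //.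
    - by rewrite /cross -pab.
    - rewrite -pab; apply: (connect_trans u'c); apply: connect1.
      by apply: hop3 pc _ ac bd ab; rewrite pab.
case: invw => [[_ /sub_near]|[_ [u' [b [/sub_near uu' _ [pu' _ _] [pb wb] u'b]]]]].
  by apply: near_le; lia.
apply: (near_trans_le uu' (n := r + 1)); last by lia.
exact: near_trans (hop_near pu' u'b) (near_sym sym_e wb).
Qed.

(** Without core vertices only the last case of [false_edge] remains, so the component stays in one
    piece within 1 of the root bag, and [r] bounds the hops there. *)
Lemma false_close_component u w : col u = false ->
  (forall v, connect (monochrome e col) u v -> ~ core v) -> connect (monochrome e col) u w ->
  near e (r + 2) u w.
Proof.
move=> cu nC uw.
have tu : touches 1 (pi u) u by case: (false_touch cu) => // /(nC _ (connect0 _ _)).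
have [b0 [ub0 pb0]] := tu.
pose inv w := col w = false /\ pi w = pi u /\ exists b,
  [/\ near e 1 w b, bag (pi u) b & connect (hop (pi u) 3) b0 b].
have [_ [_ [b [wb pb b0b]]]] : inv w.
  apply: (connect_ind (P := inv)) uw => [|a b ua [ca [pa [c [ac pc b0c]]]]].
    by split=> //; split=> //; exists b0; split=> //; apply: connect0.
  case/andP=> ab /eqP cab; have cb : col b = false by rewrite -cab.
  have ub : connect (monochrome e col) u b.
    by apply: connect_trans ua (connect1 _); rewrite /monochrome /= ab cab eqxx.
  case: (false_edge ab ca cb) => [[_ /(nC _ ub)]|[/(nC _ ua)]|[_ /(nC _ ub)]|] //.
  case=> _ [d [bd pd]] pab; split=> //; split; first by rewrite -pab.
  rewrite -pab pa in pd; exists d; split=> //.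
  by apply: (connect_trans b0c); apply: connect1; apply: hop3 pc pd ac bd ab.
apply: (near_trans_le ub0 (n := r + 1)); last by lia.
exact: near_trans (hop_near pb0 b0b) (near_sym sym_e wb).
Qed.

Lemma step_col_near u w : connect (monochrome e col) u w ->
  near e (L + k.+1 * L.+1 + (R + r + 1) * 2) u w.
Proof.
move=> uw; case cu : (col u).
  by apply: near_le (true_component cu uw); lia.
(* In a false component meeting the core, distances are measured through a core vertex, hence the
   factor 2. *)
case: (pselect (exists v, connect (monochrome e col) u v /\ core v)) => [[v [uv Cv]]|nC]; last first.
  apply: near_le (false_close_component cu _ uw); first by lia.
  by move=> v uv Cv; apply: nC; exists v.
have vu : connect (monochrome e col) v u by rewrite (sym_connect_sym (monochrome_sym _ sym_e)).
have cv : col v = false.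
  rewrite -cu; apply: (connect_ind (P := fun v => col v = col u)) uv => // a b _ <-.
  by case/andP=> _ /eqP.
apply: (near_trans_le (near_sym sym_e (false_core_component cv Cv vu))).
  exact: false_core_component cv Cv (connect_trans vu uw).
by lia.
Qed.

End Step.

Lemma weak_diameter_colouring k : exists D, forall (V : finType) (T : Type)
    (e : rel V) (par : T -> T) depth (bag : T -> V -> Prop) top,
  rooted_dec e par depth bag top -> bags_indep e bag k ->
  exists col : V -> bool, forall u v, connect (monochrome e col) u v -> near e D u v.
Proof.
elim: k => [|k [D IHk]].
  exists 0 => V T e par depth bag top [_ _ _ edgeP] indep; exists xpredT => u v uv.
  suff -> : v = u by apply: near_refl.
  apply: (connect_ind (P := fun v => v = u)) uv => // a b _ _ /andP[/edgeP[x [xa _]] _].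
  suff: size [:: a] <= 0 by [].
  by apply: (indep x) => // c; rewrite inE => /eqP->.
(* The bound, found by unification with [step_col_near], depends on [k] and [D] only. *)
eexists => V T e par depth bag top decP indepP.
have [_ forestP _ _] := decP.
have [rho rhoP] := pieces_exist forestP (hits e bag).
have [top' subP] := sub_dec decP k rhoP.
have [col' colP'] := IHk _ _ _ _ _ _ _ subP (sub_indep decP indepP rhoP).
exists (step_col e bag top k rho col') => u v.
exact: (step_col_near decP indepP rhoP colP').
Qed.

(** * Rooting a tree *)

Section TreeRooting.
Variable T : sgraph.
Hypothesis treeT : is_tree T.

Lemma tree_connect (x y : T) : connect (@edge T) x y.
Proof.
have [[_ c] _] := treeT; have := c x y; rewrite !inE => /(_ isT isT).
by apply: connect_sub => a b /and3P[_ _ ab]; apply: connect1.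
Qed.

(** A simple path avoiding the edge has at least two steps, so the edge would close it to a cycle of
    length at least three. *)
Lemma tree_cut (x y : T) : edge x y ->
  ~~ connect [rel a b | edge a b && ((a, b) \notin [:: (x, y); (y, x)])] x y.
Proof.
move=> xy; apply/negP => /connectP[p0 /shortenP[p pp up _] {p0} yE].
have [_ /(_ (x :: p))] := treeT; apply; last first.
  apply/andP; split=> //; rewrite /= rcons_path -yE edge_sym xy andbT.
  by apply: sub_path pp => a b /andP[].
case: p pp yE {up} => [|z [|//]] /=.
  by move=> _ yE; rewrite yE edge_irrefl in xy.
by rewrite andbT => /andP[_ +] yE; rewrite yE !inE eqxx.
Qed.

(** Parents are neighbours one step closer to [x0]. Every edge joins a node to its parent: otherwise
    parent chains would connect its ends through [x0] without it, against [tree_cut]. *)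
Lemma tree_rooted : exists (par : T -> T) (depth : T -> nat),
  rooted_forest par depth /\
  forall X : {set T}, induces_connected X -> exists t, topped par t (fun x => x \in X).
Proof.
have [[/set0Pn[x0 _] _] _] := treeT.
have ex_depth x : exists n, `[< near (@edge T) n x0 x >].
  by case/connectP: (tree_connect x0 x) => p pp ->; exists (size p); apply/asboolP; exists p.
pose depth x := ex_minn (ex_depth x).
have depthP x : near (@edge T) (depth x) x0 x.
  by rewrite /depth; case: ex_minnP => m /asboolP.
have depth_min n x : near (@edge T) n x0 x -> depth x <= n.
  by rewrite /depth; case: ex_minnP => m _ min_m nx; apply: min_m; apply/asboolP.
have /choice[par parP] x : exists y, y = x /\ x = x0 \/ edge y x /\ depth x = (depth y).+1.
  have := depthP x; case dE: (depth x) => [|n].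
    move=> [p [_ xE]]; rewrite leqn0 => /nilP pE.
    by exists x; left; rewrite -xE pE.
  case=> p; case/lastP: p => [|p z]; first by case=> _ /= xE _; exists x; left.
  rewrite rcons_path last_rcons size_rcons => -[/andP[pp ez] zx sp].
  rewrite zx in ez; exists (last x0 p); right; split=> //.
  have n1 : near (@edge T) n x0 (last x0 p) by exists p.
  have := depth_min _ _ n1; have := depth_min _ _ (near_rcons (depthP _) ez); lia.
have forestP : rooted_forest par depth.
  by move=> x; case: (parP x) => [[]|[_ ->]]; [left|right].
have par_edge x y : edge x y -> y = par x \/ x = par y.
  move=> xy; apply: contrapT => /not_orP[yx xyp].
  have /negP := tree_cut xy; apply; set e' := [rel a b | _].
  have sym_e' : connect_sym e'.
    apply: sym_connect_sym => a b; rewrite /= edge_sym !inE !xpair_eqE.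
    by congr (_ && ~~ _); rewrite orbC andbC [X in _ || X]andbC.
  have to_root z : connect e' z x0.
    elim/(forest_ind forestP): z => z IHz; case: (parP z) => [[_ ->]|[ez dz]].
      exact: connect0.
    have pz : par z <> z by move=> zz; move: ez; rewrite zz edge_irrefl.
    apply: (connect_trans _ (IHz pz)); apply: connect1.
    rewrite /= edge_sym ez !inE !xpair_eqE negb_or /=; apply/andP; split.
      by apply/negP => /andP[/eqP zx /eqP zy]; apply: yx; rewrite -zx -zy.
    by apply/negP => /andP[/eqP zx /eqP zy]; apply: xyp; rewrite -zx -zy.
  by apply: (connect_trans (to_root x)); rewrite sym_e'.
exists par, depth; split=> // X [/set0Pn[z0 _] Xconn].
(* A walk inside [X] from an exit [x] cannot climb above [x], so [X] lies below each of its
   exits. *)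
apply: (unique_exit_topped z0).
suff below x y : is_exit par (fun x => x \in X) x -> is_exit par (fun x => x \in X) y ->
    anc par y x.
  by move=> x y ex ey; apply: (anc_anti forestP); apply: below.
move=> [xX outx] [yX _].
apply: (connect_ind (P := fun y => anc par y x)) (Xconn x y xX yX).
  exact: anc_refl.
move=> a b _ ax /and3P[aX bX ab].
case: (par_edge a b ab) => [bE|aE]; last by apply: anc_step; rewrite -aE.
case: (anc_proper ax) => [ax'|[_]]; last by rewrite bE.
rewrite ax' in bE; case: outx => [px|]; last by rewrite -bE bX.
by move: ab; rewrite ax' bE px edge_irrefl.
Qed.

End TreeRooting.

(** * Distances, quasi-isometries and treewidth *)

Lemma distP (G : sgraph) (u v : G) :
  (exists m, [/\ dist u v = m%:R%:E, near (@edge G) m u v &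
                 forall n, near (@edge G) n u v -> m <= n]) \/
  (dist u v = +oo%E /\ forall n, ~ near (@edge G) n u v).
Proof.
have near_gpath n : near (@edge G) n u v -> exists2 m, m <= n & gpath_of_length u v m.
  move=> [p [/shortenP[p' pp' up' /uniq_leq_size sp] lp sn]].
  exists (size p'); first by apply: leq_trans sn; apply: sp; case/andP: up'.
  by apply/existsP; exists (in_tuple p'); rewrite /is_gpath pp' up' lp eqxx.
have gpath_near n : gpath_of_length u v n -> near (@edge G) n u v.
  move=> /existsP[p /and3P[pp /eqP lp _]]; exists p; split=> //.
  by rewrite size_tuple.
rewrite /dist; case: {-}_ / idP => [uv|nuv]; [left|right].
  case: ex_minnP => m mP min_m; exists m; split=> // [|n /near_gpath[m' le_m' /min_m]].
    exact: gpath_near.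
  by move=> /leq_trans; apply.
split=> // n [p [pp lp _]]; apply: nuv; apply/connectP; exists p => //.
Qed.

Lemma dist_le (G : sgraph) n (u v : G) :
  (dist u v <= n%:R%:E)%E <-> near (@edge G) n u v.
Proof.
case: (distP u v) => [[m [-> mP min_m]]|[-> nP]]; rewrite ?lee_fin ?ler_nat.
  by split=> [le_mn|/min_m//]; apply: near_le mP.
by split=> // /nP.
Qed.

(** The bound [q * n + q * q] is the lower inequality with the fraction cleared; quantifying over
    all [n] covers infinite distances. *)
Lemma quasi_isometryI q (G H : sgraph) (phi : G -> H) : 0 < q ->
  (forall n u v, near (@edge G) n u v -> near (@edge H) (q * n + q) (phi u) (phi v)) ->
  (forall n u v, near (@edge H) n (phi u) (phi v) -> near (@edge G) (q * n + q * q) u v) ->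
  (forall x, exists v, near (@edge H) q x (phi v)) ->
  quasi_isometry q phi.
Proof.
move=> q0 up low surj; split; last first.
  by move=> x; have [v xv] := surj x; exists v; apply/dist_le.
move=> u v; split; last first.
  case: (distP u v) => [[m [-> mP _]]|[-> _]].
    by rewrite -EFinM -EFinD -natrM -natrD; apply/dist_le/up.
  by rewrite gt0_muley ?lte_fin ?ltr0n // addye // leey.
case: (distP (phi u) (phi v)) => [[m [-> /low]]|[-> _]]; last by rewrite leey.
case: (distP u v) => [[n [-> _ min_n]] /min_n le_n _|[_ nP] /nP//].
rewrite -EFinM -EFinB lee_fin lerBlDr ler_pdivrMl ?ltr0n // -natrD -natrM ler_nat.
by rewrite mulnDr.
Qed.

Lemma quasi_isometry_near q (G H : sgraph) (phi : G -> H) n u v : 0 < q ->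
  quasi_isometry q phi ->
  (near (@edge G) n u v -> near (@edge H) (q * n + q) (phi u) (phi v)) /\
  (near (@edge H) n (phi u) (phi v) -> near (@edge G) (q * n + q * q) u v).
Proof.
move=> q0 [/(_ u v)[low up] _]; split=> /dist_le le_n.
  apply/dist_le; apply: le_trans up _; rewrite natrD natrM EFinD EFinM.
  by rewrite leeD2r // lee_pmul2l // lte_fin ltr0n.
apply/dist_le; have {low} := le_trans low le_n.
case: (distP u v) => [[m [-> _ _]]|[-> _]].
  rewrite -EFinM -EFinB !lee_fin lerBlDr ler_pdivrMl ?ltr0n // -natrD -natrM !ler_nat.
  by rewrite mulnDr.
by rewrite gt0_muley ?lte_fin ?invr_gt0 ?ltr0n // addye.
Qed.

Lemma weak_diameter_le (G : sgraph) d (X : {set G}) :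
  (weak_diameter X <= d%:R%:E)%E <-> {in X &, forall u v, near (@edge G) d u v}.
Proof.
have d0 : (0 <= d%:R%:E :> \bar rat)%E by rewrite lee_fin ler0n.
split=> [/bigmax_leP[_ Xd] u v uX vX|Xd].
  by apply/dist_le; have /bigmax_leP[_] := Xd u uX; apply.
apply/bigmax_leP; split=> // u uX; apply/bigmax_leP; split=> // v vX.
exact/dist_le/Xd.
Qed.

Lemma treewidth_leP (G : sgraph) n :
  (treewidth G <= n%:Z - 1)%R <->
  exists (T : sgraph) (bag : T -> {set G}), tree_decomposition bag /\ forall x, #|bag x| <= n.
Proof.
rewrite /treewidth; case: ex_minnP => m /asboolP[T [bag [bagP wm]]] min_m.
rewrite lerD2r lez_nat; split=> [le_mn|[T' [bag' [bagP' le_n]]]].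
  exists T, bag; split=> // x; apply: leq_trans le_mn.
  by move/addIr: wm => [<-]; apply: leq_bigmax.
apply: (@leq_trans (\max_(x : T') #|bag' x|)); last exact/bigmax_leqP.
by apply: min_m; apply/asboolP; exists T', bag'.
Qed.

(** * From treewidth to centred decompositions *)

(** Subtrees of adjacent vertices share a node, so they unite along walks in [W]. This is applied to
    balls in part (ii) and to monochromatic components in part (i). *)
Lemma union_connected (T : sgraph) (V : finType) (B : T -> {set V}) (e : rel V)
    (c : V) (W : pred V) :
  (forall v, induces_connected [set x | v \in B x]) ->
  (forall a b, e a b -> exists x, a \in B x /\ b \in B x) ->
  W c -> (forall v, W v -> connect [rel a b | [&& W a, W b & e a b]] c v) ->
  forall S : {set T}, (forall x, reflect (exists2 v, W v & v \in B x) (x \in S)) ->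
  induces_connected S.
Proof.
move=> Bconn eB Wc Wconn S SP.
have [/set0Pn[x0]] := Bconn c; rewrite inE => cx0 _.
split; first by apply/set0Pn; exists x0; apply/SP; exists c.
set eS := [rel a b | _].
have inS v x y : W v -> v \in B x -> v \in B y -> connect eS x y.
  move=> Wv vx vy; have [_ /(_ x y)] := Bconn v; rewrite !inE => /(_ vx vy).
  apply: connect_sub => a b; rewrite /= !inE => /and3P[va vb ab]; apply: connect1.
  by rewrite /= ab andbT; apply/andP; split; apply/SP; exists v.
have from_x0 v : W v -> forall x, v \in B x -> connect eS x0 x.
  move=> Wv; apply: (connect_ind (P := fun v => forall x, v \in B x -> connect eS x0 x)) (Wconn v Wv).
    by move=> x; apply: inS.
  move=> a b _ IHa /and3P[Wa Wb /eB[y [ya yb]]] x xb.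
  by apply: connect_trans (IHa y ya) (inS b y x Wb yb xb).
have symS : connect_sym eS.
  by apply: sym_connect_sym => a b; rewrite /= edge_sym andbCA.
move=> x y /SP[v Wv vx] /SP[w Ww wy].
by apply: (@connect_trans _ _ x0); [rewrite symS; apply: from_x0 vx|apply: from_x0 wy].
Qed.

Lemma centred_of_treewidth c k (G H : sgraph) : 0 < c -> quasi_isometric c G H ->
  (treewidth H <= k%:Z)%R -> has_centred_tree_decomposition G (k + 1) (3 * c ^ 2).
Proof.
move=> c0 [phi phiP] twH.
have /treewidth_leP[T [B [[treeT BE Bconn] Bcard]]] : (treewidth H <= (k + 1)%:Z - 1)%R.
  by rewrite PoszD addrK.
have nearGH n u v := quasi_isometry_near n u v c0 phiP.
pose ball v := [pred w | `[< near (@edge H) c (phi v) w >]].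
pose bag x := [set v | [exists w in ball v, w \in B x]].
exists T, bag; split.
  split=> // [u v uv|v].
    (* [phi u] and [phi v] are within [c + c], so a midpoint [w] lies in both balls, and any bag of
       [w] serves. *)
    have := (nearGH 1 u v).1 (near_edge uv); rewrite muln1 => nuv.
    have [w [uw wv]] := near_split nuv.
    have [/set0Pn[x]] := Bconn w; rewrite inE => wx _; exists x; rewrite !inE.
    split; apply/existsP; exists w; rewrite wx andbT inE; apply/asboolP => //.
    by apply: near_sym wv; apply: edge_sym.
  apply: (union_connected (c := phi v) (W := ball v) Bconn BE).
  - exact/asboolP/near_refl.
  - move=> w /asboolP[p [pp <- sp]]; elim/last_ind: p pp sp => [|p z IHp]; first by rewrite connect0.
    rewrite rcons_path last_rcons size_rcons => /andP[pp ez] sp.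
    apply: connect_trans (IHp pp (ltnW sp)) (connect1 _).
    rewrite /= ez andbT; apply/andP; split; apply/asboolP; first by exists p; rewrite ltnW.
    by exists (rcons p z); rewrite rcons_path pp last_rcons size_rcons.
  - move=> x; rewrite !inE; apply: (iffP existsP) => [[w /andP[? ?]]|[w ? ?]]; exists w => //.
    exact/andP.
move=> x; have [f fP] : exists f : G -> H, forall v, v \in bag x ->
    near (@edge H) c (phi v) (f v) /\ f v \in B x.
  suff /choice[f fP] : forall v, exists w, v \in bag x -> near (@edge H) c (phi v) w /\ w \in B x.
    by exists f.
  move=> v; case: (boolP (v \in bag x)) => [|_]; last by exists (phi v).
  by rewrite inE => /existsP[w /andP[/asboolP vw wx]]; exists w.
exists (preim_partition f (bag x)); split; first exact: preim_partitionP.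
  apply: leq_trans (Bcard x); apply: leq_trans (leq_imset_card (fun w => [set v in bag x | w == f v]) _).
  apply/subset_leq_card/subsetP => _ /imsetP[v vx ->].
  by apply/imsetP; exists (f v) => //; have [] := fP v vx.
move=> X /imsetP[v vx ->]; apply/weak_diameter_le => a b.
move=> /setIdP[ax /eqP va] /setIdP[bx /eqP vb].
have [[na _] [nb _]] := (fP a ax, fP b bx).
have -> : 3 * c ^ 2 = c * (c + c) + c * c by rewrite mulnDr -mulnn; lia.
apply: (nearGH (c + c) a b).2; apply: near_trans na _; rewrite -va vb; apply: near_sym nb; exact: edge_sym.
Qed.

(** * Contracting monochromatic components *)

Section Quotient.
Variables (G : sgraph) (m : rel G).
Hypothesis sym_m : connect_sym m.

Definition class := {v : G | roots m v}.
Definition rep (v : G) : class := Sub (fingraph.root m v) (roots_root sym_m v).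

Lemma rep_eq u v : (rep u == rep v) = connect m u v.
Proof. by rewrite -val_eqE /= root_connect. Qed.

Lemma rep_val (a : class) : rep (val a) = a.
Proof. by apply: val_inj; apply/eqP; exact: (valP a). Qed.

Definition quotient_edge : rel class := [rel a b | (a != b) &&
  [exists u, exists v, [&& rep u == a, rep v == b & edge u v]]].

Lemma quotient_edge_sym : symmetric quotient_edge.
Proof.
suff h a b : quotient_edge a b -> quotient_edge b a by move=> a b; apply/idP/idP; apply: h.
case/andP=> ab /existsP[u /existsP[v /and3P[ua vb uv]]]; rewrite /quotient_edge /= eq_sym ab.
by apply/existsP; exists v; apply/existsP; exists u; rewrite ua vb edge_sym.
Qed.

Lemma quotient_edge_irrefl : irreflexive quotient_edge.
Proof. by move=> a; rewrite /quotient_edge /= eqxx. Qed.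

Definition quotient : sgraph := SGraph quotient_edge_sym quotient_edge_irrefl.

(** Walks project without getting longer. Conversely, each edge of the quotient lifts to at most [C]
    steps in a component and one edge, with [C] more steps at the end. *)
Lemma quotient_quasi_isometry C :
  (forall u v, connect m u v -> near (@edge G) C u v) ->
  quasi_isometry C.+1 (rep : G -> quotient).
Proof.
move=> mC; apply: quasi_isometryI => // [n u v uv|n u v|a].
- have : near (@edge quotient) (1 * n) (rep u) (rep v).
    case: uv => p [pp <- sp]; apply: (@near_le _ _ (size p)); first by rewrite mul1n.
    elim: p u pp {sp} => [|w p IHp] u /=; first by move=> _; apply: near_refl.
    case/andP=> uw /IHp wv; rewrite -add1n; apply: near_trans wv.
    apply/near1P; rewrite /= /quotient_edge /=; case: eqVneq => //= _.
    by apply/existsP; exists u; apply/existsP; exists w; rewrite !eqxx.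
  by apply: near_le; rewrite mul1n mulSn; lia.
- case=> p [pp lp sp]; apply: (@near_le _ _ (C.+1 * size p + C)); first by nia.
  elim: p u pp lp {sp} => [|b p IHp] u /=.
    by move=> _ /eqP; rewrite rep_eq => /mC uv; apply: near_le uv; lia.
  case/andP=> /andP[_ /existsP[u' /existsP[v' /and3P[]]]].
  rewrite rep_eq sym_m => uu' /eqP v'b u'v'; rewrite -v'b => pp lp.
  apply: (near_trans_le (mC _ _ uu') (near_trans (near_edge u'v') (IHp v' pp lp))).
  by rewrite mulnS !addnA !leq_add2r addn1.
- by exists (val a); rewrite rep_val; apply: near_refl.
Qed.

End Quotient.

(** Each part of the partition is a clique of [e], so an independent sequence has at most one vertex
    in it. *)
Lemma centred_indep (G : sgraph) (e : rel G) k d (S : {set G}) : centred_set k d S ->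
  {in S &, forall u v, near (@edge G) d u v -> e u v} ->
  forall s, (forall u, u \in s -> u \in S) -> independent e s -> size s <= k.
Proof.
move=> [P [partP Pk Pd]] eS s sS s_ind; have /and3P[/eqP coverP trivP _] := partP.
apply: leq_trans Pk; rewrite cardE -(size_map (pblock P)); apply: uniq_leq_size.
  rewrite uniq_pairwise pairwise_map; apply: (sub_in_pairwise (P := [in s])) s_ind; last exact/allP.
  move=> u v us vs /= /andP[_]; apply: contra => /eqP uv; apply: eS; [exact: sS..|].
  have uP : u \in cover P by rewrite coverP sS.
  have vP : v \in cover P by rewrite coverP sS.
  have /weak_diameter_le := Pd _ (pblock_mem uP); apply; first by rewrite mem_pblock.
  by rewrite uv mem_pblock.
by move=> _ /mapP[u us ->]; rewrite mem_enum pblock_mem // coverP sS.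
Qed.

Lemma quasi_isometric_of_centred k d (G : sgraph) D :
  (forall (V T : finType) (e : rel V) (par : T -> T) depth (bag : T -> V -> Prop) top,
    rooted_dec e par depth bag top -> bags_indep e bag k ->
    exists col : V -> bool, forall u v, connect (monochrome e col) u v -> near e D u v) ->
  has_centred_tree_decomposition G k d ->
  exists H : sgraph, quasi_isometric (d * D).+1 G H /\ (treewidth H <= (2 * k)%:Z - 1)%R.
Proof.
move=> colouring [T [B [[treeT BE Bconn] Bcentred]]].
(* Requiring a common bag makes [B] a decomposition for [e] as well. *)
pose e : rel G := [rel u v |
  [exists x, (u \in B x) && (v \in B x)] && `[< near (@edge G) d u v >] ].
have sym_e : symmetric e.
  suff h u v : e u v -> e v u by move=> u v; apply/idP/idP; apply: h.
  case/andP=> /existsP[x /andP[ux vx]] /asboolP uv; apply/andP; split.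
    by apply/existsP; exists x; rewrite ux vx.
  by apply/asboolP; apply: near_sym uv; apply: edge_sym.
have eB u v : e u v -> exists x, u \in B x /\ v \in B x.
  by case/andP=> /existsP[x /andP[]]; exists x.
have [par [depth [forestP toppedP]]] := tree_rooted treeT.
have /choice[top topP] v : exists t, topped par t (fun x => v \in B x).
  have [t tP] := toppedP _ (Bconn v); exists t => x vx.
  by have := tP x; rewrite !inE; apply.
have decP : rooted_dec e par depth (fun x v => v \in B x) top by split.
have indepP : bags_indep e (fun x v => v \in B x) k.
  move=> x s; apply: centred_indep (Bcentred x) _ s => u v ux vx uv.
  by apply/andP; split; [apply/existsP; exists x; rewrite ux vx|apply/asboolP].
have [col colP] := colouring _ _ _ _ _ _ _ decP indepP.
have sym_m : connect_sym (monochrome e col) := sym_connect_sym (monochrome_sym col sym_e).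
exists (quotient sym_m); split.
  exists (rep sym_m); apply: quotient_quasi_isometry => u v /colP.
  by apply: near_scale => a b /andP[_ /asboolP].
apply/treewidth_leP; exists T, (fun x => [set rep sym_m v | v in B x]); split.
  split=> // [a b|a].
    case/andP=> _ /existsP[u /existsP[v /and3P[/eqP <- /eqP <- /BE[x [ux vx]]]]].
    by exists x; split; apply: imset_f.
  apply: (union_connected (c := val a) (W := [pred v | rep sym_m v == a]) Bconn eB).
  - by rewrite /= rep_val.
  - move=> v /=; rewrite -{1}(rep_val sym_m a) eq_sym rep_eq.
    apply: (connect_ind (P := connect _ (val a))); first exact: connect0.
    move=> b c ab IHb bc; apply: connect_trans IHb (connect1 _).
    have repE z : connect (monochrome e col) (val a) z -> rep sym_m z == a.
      by rewrite -(rep_eq sym_m) rep_val eq_sym.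
    rewrite /= !repE //; first by case/andP: bc.
    by apply: connect_trans ab (connect1 bc).
  - move=> x; rewrite inE; apply: (iffP imsetP) => [[v vx ->]|[v /eqP <- vx]].
      by exists v => //=.
    by exists v.
move=> x; set bag' := imset _ _.
(* Picking from the bag one vertex of each component of one colour gives an independent set:
   adjacent vertices of equal colour share a component. *)
have half (A : {set quotient sym_m}) b : A \subset bag' ->
    (forall a, a \in A -> col (val a) = b) -> #|A| <= k.
  move=> /subsetP Abag colA.
  have [f fP] : exists f : quotient sym_m -> G, forall a, a \in A ->
      f a \in B x /\ rep sym_m (f a) = a.
    suff /choice[f fP] : forall a, exists v, a \in A -> v \in B x /\ rep sym_m v = a by exists f.
    move=> a; case: (boolP (a \in A)) => [/Abag/imsetP[v vx ->]|_]; last by exists (val a).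
    by exists v.
  rewrite cardE -(size_map f); apply: (indepP x) => [u /mapP[a + ->]|].
    by rewrite mem_enum => /fP[].
  have := enum_uniq A; rewrite uniq_pairwise /independent pairwise_map.
  apply: (sub_in_pairwise (P := [in A])); last by apply/allP => a; rewrite mem_enum.
  move=> a b' aA bA' /= aNb; have [[_ fa] [_ fb]] := (fP a aA, fP b' bA').
  have colE z : z \in A -> col (f z) = b.
    move=> zA; rewrite -(colA z zA); apply: (connect_monochrome_col (e := e)).
    by rewrite -(rep_eq sym_m) rep_val; have [_ ->] := fP z zA.
  apply/andP; split; first by apply: contra aNb => /eqP fab; rewrite -fa -fb fab.
  apply: contra aNb => eab; rewrite -fa -fb rep_eq; apply: connect1.
  by rewrite /monochrome /= eab !colE // eqxx.
rewrite -(cardsID [set a : quotient sym_m | col (val a)] bag') mul2n -addnn.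
apply: leq_add.
  by apply: (half _ true); [apply: subsetIl|move=> a; rewrite !inE => /andP[_ ->]].
by apply: (half _ false); [apply: subsetDl|move=> a; rewrite !inE => /andP[/negbTE->]].
Qed.

Theorem theorem1 :
  exists q : nat -> nat -> nat,
    (forall k d : nat, (0 < k)%N -> (0 < d)%N -> (0 < q k d)%N) /\
    forall c d k : nat, (0 < c)%N -> (0 < d)%N -> (0 < k)%N ->
      (forall G : sgraph,
         has_centred_tree_decomposition G k d ->
         exists H : sgraph,
           quasi_isometric (q k d) G H /\
           (treewidth H <= (2 * k)%:Z - 1)%R) /\
      (forall G : sgraph,
         (exists H : sgraph,
            quasi_isometric c G H /\ (treewidth H <= k%:Z)%R) ->
         has_centred_tree_decomposition G (k + 1) (3 * c ^ 2)).
Proof.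
have [D DP] := choice weak_diameter_colouring.
(* Component diameters in [G] are at most [d * D k]; [quotient_quasi_isometry] adds 1. *)
exists (fun k d => (d * D k).+1); split=> // c d k c0 d0 k0; split=> G.
  by apply: quasi_isometric_of_centred => // V T; apply: DP.
by move=> [H [GH twH]]; apply: centred_of_treewidth GH twH.
Qed.
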